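(* Let $G=(V,E)$ be a signed graph with $|V|=4$. Then $G$ is signed-eliminable if and only if at least one of the following conditions is satisfied: (FV1) $G_+$ or $G_-$ has a vertex of degree three. (FV2) Both $G_+$ and $G_-$ are chordal, $G$ is not a mountain, and $G$ has no alternating $4$-path.
   Context: All graphs are finite, simple and undirected. A signed graph is a graph $G=(V,E)$ together with a partition $E=E_+\sqcup E_-$ (either part may be empty); put $G_\sigma=(V,E_\sigma)$ for $\sigma\in\{+,-\}$, and let $-\sigma$ be the opposite sign. A graph is chordal if it has no induced cycle of length at least four. An ordering on $G$ is a bijection $\nu:V\to\{1,\dots,|V|\}$. It is a signed elimination ordering (SEO) if for every triple $(u,v,w)$ of distinct vertices with $\nu(u)<\nu(w)>\nu(v)$ and each $\sigma\in\{+,-\}$: (E1) if $uw,wv\in E_\sigma$ then $uv\in E_\sigma$; (E2) if $uv\in E_\sigma$ and $vw\in E_{-\sigma}$ then $uw\in E_\sigma$. $G$ is signed-eliminable if it admits a SEO. An alternating $4$-path in $G$ consists of four distinct vertices $u,v,w,x$ and a sign $\sigma\in\{+,-\}$ with $uv\in E_\sigma$, $vw\in E_{-\sigma}$, $wx\in E_\sigma$ (other pairs among these vertices may or may not be edges). A mountain is a signed graph for which there are $\sigma\in\{+,-\}$ and an enumeration $(v_1,\dots,v_n;w)$ of its (distinct) vertices, $n\ge 3$, such that $v_iv_{i+1}\in E_{-\sigma}$ for $1\le i\le n-1$, $wv_i\in E_\sigma$ for $2\le i\le n-1$, and no other pair of vertices is joined by an edge. *)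

(* Defs.v *)
From mathcomp Require Import all_boot.

Set Implicit Arguments.
Unset Strict Implicit.
Unset Printing Implicit Defensive.

(* Signs are booleans: [true] is +, [false] is -, and [~~ s] is the opposite
   sign.  [sedge G s] is the adjacency relation of the simple graph G_s; the
   edge set of the underlying graph is the disjoint union of the two. *)
Record sgraph (V : finType) := SGraph {
  sedge : bool -> rel V;
  sedge_sym : forall s, symmetric (sedge s);
  sedge_irrefl : forall s, irreflexive (sedge s);
  sedge_disjoint : forall s x y, sedge s x y -> ~~ sedge (~~ s) x y
}.

Definition degree (V : finType) (e : rel V) (x : V) : nat := #|[set y | e x y]|.

(* For [uniq c], [next c] is the cyclic successor in [c]. *)
Definition induced_cycle (V : finType) (e : rel V) (c : seq V) : Prop :=
  uniq c /\
  forall x y, x \in c -> y \in c -> e x y = (y == next c x) || (x == next c y).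

Definition chordal (V : finType) (e : rel V) : Prop :=
  ~ exists c : seq V, 4 <= size c /\ induced_cycle e c.

Section SignedGraphs.

Variables (V : finType) (G : sgraph V).

(* Orderings take the values 0, ..., |V|-1 instead of 1, ..., |V|. *)
Definition signed_elimination_ordering (nu : V -> 'I_#|V|) : Prop :=
  bijective nu /\
  forall u v w : V, uniq [:: u; v; w] -> nu u < nu w -> nu v < nu w ->
  forall s : bool,
    (sedge G s u w -> sedge G s w v -> sedge G s u v) /\
    (sedge G s u v -> sedge G (~~ s) v w -> sedge G s u w).

Definition signed_eliminable : Prop :=
  exists nu : V -> 'I_#|V|, signed_elimination_ordering nu.

Definition alternating_4path : Prop :=
  exists (u v w x : V) (s : bool),
    [/\ uniq [:: u; v; w; x], sedge G s u v, sedge G (~~ s) v w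
      & sedge G s w x].

(* The vertices v_1, ..., v_n are indexed here by 0, ..., n-1.  The four
   equations determine all adjacencies, hence also all non-adjacencies. *)
Definition mountain : Prop :=
  exists (s : bool) (n : nat) (v : 'I_n -> V) (w : V),
    [/\ 3 <= n, injective v, forall i, v i != w
      & forall x, x = w \/ exists i, x = v i] /\
    [/\ forall i j : 'I_n,
          sedge G (~~ s) (v i) (v j) = (j == i.+1 :> nat) || (i == j.+1 :> nat),
        forall i j : 'I_n, sedge G s (v i) (v j) = false,
        forall i : 'I_n, sedge G s w (v i) = (0 < i < n.-1)
      & forall i : 'I_n, sedge G (~~ s) w (v i) = false].

End SignedGraphs.

(* Main.v *)
Require Import Defs.
From mathcomp Require Import all_boot.

Set Implicit Arguments.
Unset Strict Implicit.
Unset Printing Implicit Defensive.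

(** On four vertices, each of the properties involved (being signed-eliminable,
    a vertex of degree three, an induced 4-cycle, a mountain, an alternating
    4-path) says that some enumeration x, y, z, t of the vertices satisfies a
    condition on the six signs of xy, xz, xt, yz, yt, zt.  The equivalence thus
    becomes a check over the 3^6 sign assignments and the 24 enumerations. *)

(* [None] is the sign of a non-edge. *)
Notation sign := (option bool).

(* The arguments are the signs of xy, xz, xt, yz, yt, zt. *)
Notation pattern := (sign -> sign -> sign -> sign -> sign -> sign -> bool).

(** * Conditions on six signs *)

Definition has_bool (p : pred bool) := p true || p false.
Definition all_bool (p : pred bool) := p true && p false.

Lemma has_boolP (p : pred bool) : reflect (exists s, p s) (has_bool p).
Proof.
apply: (iffP orP) => [[ps | ps] | [[] ps]];
  by [exists true | exists false | left | right].
Qed.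

Lemma all_boolP (p : pred bool) : reflect (forall s, p s) (all_bool p).
Proof. by apply: (iffP andP) => [[pt pf] [] | ps]. Qed.

(** Here [w] comes last in the ordering. The conjuncts are (E1), then (E2) for [(u, v, w)] and for
    [(v, u, w)]; as (E1) is symmetric in [u] and [v], one test covers both orders of the pair. *)
Definition seo_triple (uv uw vw : sign) : bool :=
  all_bool (fun s =>
    [&& (uw == Some s) && (vw == Some s) ==> (uv == Some s),
        (uv == Some s) && (vw == Some (~~ s)) ==> (uw == Some s)
      & (uv == Some s) && (uw == Some (~~ s)) ==> (vw == Some s)]).

Lemma seo_tripleC uv uw vw : seo_triple uv uw vw = seo_triple uv vw uw.
Proof. by case: uv uw vw => [[]|] [[]|] [[]|]. Qed.

(** The vertices x, y, z, t are listed in increasing order of [nu], so the last vertex of each of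
    the four triples is its largest. *)
Definition seo_pattern : pattern := fun xy xz xt yz yt zt =>
  [&& seo_triple xy xz yz, seo_triple xy xt yt,
      seo_triple xz xt zt & seo_triple yz yt zt].

Definition star_pattern : pattern := fun xy xz xt _ _ _ =>
  has_bool (fun s => [&& xy == Some s, xz == Some s & xt == Some s]).

(** The cycle is x, y, z, t. Its diagonals may carry the opposite sign, since it is induced in $G_s$
    and not in the whole graph. *)
Definition cycle_pattern : pattern := fun xy xz xt yz yt zt =>
  has_bool (fun s =>
    [&& xy == Some s, yz == Some s, zt == Some s, xt == Some s,
        xz != Some s & yt != Some s]).

(* The apex of the mountain is t. *)
Definition mountain_pattern : pattern := fun xy xz xt yz yt zt =>
  has_bool (fun s =>
    [&& xy == Some (~~ s), yz == Some (~~ s), yt == Some s,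
        xz == None, xt == None & zt == None]).

Definition path_pattern : pattern := fun xy _ _ yz _ zt =>
  has_bool (fun s => [&& xy == Some s, yz == Some (~~ s) & zt == Some s]).

(** * The finite check on vertices 0, 1, 2, 3 *)

Section Numbering.

Variables c01 c02 c03 c12 c13 c23 : sign.

(** The default [None] on the diagonal agrees with the absence of loops, see [edge_sign_refl]. *)
Definition sign_nat (i j : nat) : sign :=
  match i, j with
  | 0, 1 | 1, 0 => c01
  | 0, 2 | 2, 0 => c02
  | 0, 3 | 3, 0 => c03
  | 1, 2 | 2, 1 => c12
  | 1, 3 | 3, 1 => c13
  | 2, 3 | 3, 2 => c23
  | _, _ => None
  end.

Definition matches_nat (P : pattern) (p : seq nat) : bool :=
  if p is [:: i; j; k; l] then
    P (sign_nat i j) (sign_nat i k) (sign_nat i l)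
      (sign_nat j k) (sign_nat j l) (sign_nat k l)
  else false.

Definition occurs_nat (P : pattern) : bool :=
  has (matches_nat P) (permutations (iota 0 4)).

Definition classification_nat : bool :=
  occurs_nat seo_pattern ==
    occurs_nat star_pattern ||
    [&& ~~ occurs_nat cycle_pattern, ~~ occurs_nat mountain_pattern
      & ~~ occurs_nat path_pattern].

End Numbering.

Definition all_sign (p : pred sign) := [&& p None, p (Some true) & p (Some false)].

Lemma all_signP (p : pred sign) : all_sign p -> forall c, p c.
Proof. by case/and3P=> pn pt pf [[]|]. Qed.

(** The nested [all_sign] make the claim a closed boolean, which is evaluated on all 729 sign
    assignments. *)
Lemma classification_natP c01 c02 c03 c12 c13 c23 :
  classification_nat c01 c02 c03 c12 c13 c23.
Proof.
have: all_sign (fun a => all_sign (fun b => all_sign (fun c =>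
      all_sign (fun d => all_sign (fun e => all_sign (fun f =>
      classification_nat a b c d e f)))))) by vm_compute.
move/all_signP/(_ c01)/all_signP/(_ c02)/all_signP/(_ c03).
by move/all_signP/(_ c12)/all_signP/(_ c13)/all_signP/(_ c23).
Qed.

(** * From graphs on four vertices to sign assignments *)

Section FourVertices.

Variables (V : finType) (G : sgraph V).
Hypothesis card4 : #|V| = 4.

Definition edge_sign (x y : V) : sign :=
  if sedge G true x y then Some true
  else if sedge G false x y then Some false else None.

(** [edge_sign] tests + first; disjointness of the two edge sets ensures that this never hides a
    negative edge. *)
Lemma edge_signE s x y : (edge_sign x y == Some s) = sedge G s x y.
Proof.
rewrite /edge_sign; have := sedge_disjoint (s := s) (x := x) (y := y) (s0 := G).
by case: s => /=; do 2 case: (sedge _ _ _ _) => //; move/(_ isT).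
Qed.

Lemma edge_sign_None x y : (edge_sign x y == None) = [forall s, ~~ sedge G s x y].
Proof.
apply/eqP/forallP => [c s | nes]; first by rewrite -edge_signE c.
by case c: (edge_sign x y) (nes true) => [s|] // _;
  have:= nes s; rewrite -edge_signE c eqxx.
Qed.

Lemma edge_signC x y : edge_sign x y = edge_sign y x.
Proof. by rewrite /edge_sign !(sedge_sym _ _ x). Qed.

Lemma edge_sign_refl x : edge_sign x x = None.
Proof. by rewrite /edge_sign !sedge_irrefl. Qed.

Definition occurs (P : pattern) : Prop :=
  exists x y z t, uniq [:: x; y; z; t] /\
    P (edge_sign x y) (edge_sign x z) (edge_sign x t)
      (edge_sign y z) (edge_sign y t) (edge_sign z t).

Lemma mem_uniq4 (s : seq V) : uniq s -> size s = 4 -> s =i V.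
Proof.
move=> us ss v; have [] // := uniq_min_size us (s2 := enum V).
- by move=> x; rewrite mem_enum.
- by rewrite -cardE card4 ss.
by move=> _ ->; rewrite mem_enum.
Qed.

(** Once a, b, c, d is fixed as reference enumeration, [nth] turns a permutation of 0, 1, 2, 3 into
    an enumeration of the vertices, and [index] inverts this. *)
Lemma occursP (a b c d : V) (P : pattern) : uniq [:: a; b; c; d] ->
  reflect (occurs P)
    (occurs_nat (edge_sign a b) (edge_sign a c) (edge_sign a d)
                (edge_sign b c) (edge_sign b d) (edge_sign c d) P).
Proof.
set s := [:: a; b; c; d] => us.
pose cn := sign_nat (edge_sign a b) (edge_sign a c) (edge_sign a d)
                    (edge_sign b c) (edge_sign b d) (edge_sign c d).
have cnE i j : i < 4 -> j < 4 -> edge_sign (nth a s i) (nth a s j) = cn i j.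
  by move: i j => [|[|[|[|?]]]] [|[|[|[|?]]]] //= _ _;
    rewrite ?edge_sign_refl // edge_signC.
apply: (iffP hasP) => [[p] | [x [y [z [t [uxyzt Pxyzt]]]]]].
  rewrite mem_permutations perm_sym => pp; have/perm_size := pp.
  case: p pp => [|i [|j [|k [|l []]]]] // pp _ Pijkl.
  have lt4 m : m \in [:: i; j; k; l] -> m < 4.
    by rewrite -(perm_mem pp) mem_iota.
  have [Hi Hj Hk Hl] : [/\ i < 4, j < 4, k < 4 & l < 4].
    by split; apply: lt4; rewrite !inE eqxx ?orbT.
  exists (nth a s i), (nth a s j), (nth a s k), (nth a s l).
  split; last by rewrite !cnE.
  have := perm_uniq pp; rewrite iota_uniq => /esym uijkl.
  rewrite (_ : [:: _; _; _; _] = map (nth a s) [:: i; j; k; l]) //.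
  rewrite map_inj_in_uniq // => m n /lt4 Hm /lt4 Hn /eqP.
  by rewrite nth_uniq // => /eqP.
have sV v : v \in s by rewrite mem_uniq4.
have idx v : index v s < 4 by rewrite -[4]/(size s) index_mem.
have cn_index v w : cn (index v s) (index w s) = edge_sign v w.
  by rewrite -cnE // !nth_index.
exists [:: index x s; index y s; index z s; index t s]; last first.
  by rewrite /matches_nat -/cn !cn_index.
rewrite -[[:: _; _; _; _]]/(map (index^~ s) [:: x; y; z; t]).
rewrite mem_permutations; apply: uniq_perm; rewrite ?iota_uniq //.
  rewrite map_inj_in_uniq // => u v _ _ /(congr1 (nth a s)).
  by rewrite !nth_index.
move=> m; rewrite mem_iota; apply/mapP/idP => [[v _ ->] | Hm]; first exact: idx.
by exists (nth a s m); [rewrite mem_uniq4 | rewrite index_uniq].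
Qed.

Lemma classification :
  occurs seo_pattern <->
    occurs star_pattern \/
    [/\ ~ occurs cycle_pattern, ~ occurs mountain_pattern
      & ~ occurs path_pattern].
Proof.
have := enum_uniq V; have := cardE V; rewrite card4.
(* [enum V] serves as the reference enumeration. *)
case: (enum V) => [|a [|b [|c [|d []]]]] // _ us.
have /eqP E := classification_natP (edge_sign a b) (edge_sign a c)
  (edge_sign a d) (edge_sign b c) (edge_sign b d) (edge_sign c d).
split.
  move/(occursP _ us); rewrite E => /orP[/(occursP _ us)|]; first by left.
  case/and3P=> nc nm np; right.
  by split=> /(occursP _ us) => [C|C|C]; [move: nc | move: nm | move: np]; rewrite C.
move=> H; apply/(occursP _ us); rewrite E; case: H => [/(occursP _ us)->//|[nc nm np]].
by apply/orP; right; apply/and3P; split; apply/negP => /(occursP _ us).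
Qed.

(** * Each graph property as the occurrence of a pattern *)

Lemma uniq4_neq (x y z t : V) : uniq [:: x; y; z; t] ->
  (((x == y) = false) * ((x == z) = false) * ((x == t) = false) *
   ((y == z) = false) * ((y == t) = false) * ((z == t) = false) *
   ((y == x) = false) * ((z == x) = false) * ((t == x) = false) *
   ((z == y) = false) * ((t == y) = false) * ((t == z) = false))%type.
Proof.
rewrite !(eq_sym y x, eq_sym z x, eq_sym t x, eq_sym z y, eq_sym t y, eq_sym t z).
rewrite /= !inE !negb_or !andbT -!andbA.
by case/and5P=> /negPf-> /negPf-> /negPf-> /negPf-> /andP[/negPf-> /negPf->].
Qed.

Lemma star_occurs :
  (exists s x, degree (sedge G s) x = 3) <-> occurs star_pattern.
Proof.
split=> [[s [x]] | [x [y [z [t [u /has_boolP[s]]]]]]].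
  rewrite /degree cardE => sz; have := enum_uniq [set y | sedge G s x y].
  have: {in enum [set y | sedge G s x y], forall y, sedge G s x y}.
    by move=> y; rewrite mem_enum inE.
  case: (enum _) sz => [|y [|z [|t []]]] // _ adj u.
  have [xy xz xt] : [/\ sedge G s x y, sedge G s x z & sedge G s x t].
    by split; apply: adj; rewrite !inE eqxx ?orbT.
  exists x, y, z, t; split; last by apply/has_boolP; exists s; rewrite !edge_signE xy xz.
  (* The centre is not its own neighbour, so it differs from the three neighbours. *)
  rewrite cons_uniq u andbT; apply/negP => /adj; by rewrite sedge_irrefl.
rewrite !edge_signE => /and3P[xy xz xt]; exists s, x.
(* The neighbours of the centre are exactly the three other vertices. *)
rewrite /degree (_ : [set _ | _] = ~: [set x]) ?cardsC1 ?card4 //.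
apply/setP=> v; rewrite !inE; have: v \in [:: x; y; z; t] by rewrite mem_uniq4.
have neq := uniq4_neq u.
by rewrite !inE => /or4P[]/eqP->; rewrite ?(eqxx, neq) ?sedge_irrefl ?xy ?xz ?xt.
Qed.

Lemma cycle_occurs :
  (forall s, chordal (sedge G s)) <-> ~ occurs cycle_pattern.
Proof.
split=> [ch [x [y [z [t [u /has_boolP[s]]]]]] | no s [c [sz [uc ic]]]].
  rewrite !edge_signE => /and5P[xy yz zt xt /andP[/negPf xz /negPf yt]].
  apply: (ch s); exists [:: x; y; z; t]; split=> //; split=> //.
  have neq := uniq4_neq u.
  have adj := (xy, yz, zt, xt, xz, yt, sedge_irrefl).
  have adjC := (etrans (sedge_sym G s y x) xy, etrans (sedge_sym G s z y) yz,
    etrans (sedge_sym G s t z) zt, etrans (sedge_sym G s t x) xt,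
    etrans (sedge_sym G s z x) xz, etrans (sedge_sym G s t y) yt).
  by move=> v w; rewrite !inE => /or4P[]/eqP-> /or4P[]/eqP->;
    rewrite ?adj ?adjC /= ?(eqxx, neq).
(* A cycle of length at least four without repetition must use each of the four vertices once. *)
have sz4 : size c = 4.
  by apply/eqP; rewrite eqn_leq sz andbT -card4 cardE uniq_leq_size // => v;
    rewrite mem_enum.
case: c sz4 uc ic {sz} => [|x [|y [|z [|t []]]]] // _ u ic.
apply: no; exists x, y, z, t; split=> //; apply/has_boolP; exists s.
rewrite !edge_signE !ic ?inE ?eqxx ?orbT //=.
by rewrite /= ?(eqxx, uniq4_neq u).
Qed.

Lemma path_occurs : alternating_4path G <-> occurs path_pattern.
Proof.
split=> [[x [y [z [t [s [u xy yz zt]]]]]] | [x [y [z [t [u /has_boolP[s]]]]]]].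
  by exists x, y, z, t; split=> //; apply/has_boolP; exists s; rewrite !edge_signE xy yz.
by rewrite !edge_signE => /and3P[xy yz zt]; exists x, y, z, t, s.
Qed.

Lemma mountain_occurs : mountain G <-> occurs mountain_pattern.
Proof.
split=> [[s [n [v [w [[n3 injv vw sur] [ridge flat apex wv]]]]]]
        | [x [y [z [t [u /has_boolP[s]]]]]]].
  have uwv : uniq (w :: codom v).
    rewrite /= (map_inj_uniq injv) enum_uniq andbT.
    by apply/codomP => -[i wi]; have:= vw i; rewrite wi eqxx.
  (* The apex and the n ridge vertices exhaust [V], so n + 1 = 4. *)
  have {n3} n4 : n = 3.
    have /card_uniqP/= := uwv; rewrite size_codom card_ord.
    rewrite (eq_card (B := V)) ?card4 => [[]//|x].
    by rewrite !inE; case: (sur x) => [->|[i ->]]; rewrite ?eqxx ?codom_f ?orbT.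
  subst n; pose i0 : 'I_3 := ord0; pose i1 : 'I_3 := inord 1; pose i2 : 'I_3 := ord_max.
  have E1 : i1 = 1 :> nat by rewrite inordK.
  exists (v i0), (v i1), (v i2), w; split; last first.
    apply/has_boolP; exists s; rewrite !edge_signE !edge_sign_None.
    rewrite ridge E1 /= ridge E1 /= sedge_sym apex E1 /=.
    (* The three non-edges: the two ends of the ridge, and the apex with either end. Each is checked
       for [s] and for the opposite sign. *)
    apply/and3P; split; apply/forallP => s'.
    - by case: (altP (s' =P s)) => [->|/negPf]; rewrite ?flat //;
        case: s s' {flat apex wv} ridge => -[] //= -> _.
    - by rewrite sedge_sym; case: (altP (s' =P s)) => [->|]; rewrite ?apex //;
        case: s s' {flat apex ridge} wv => -[] //= ->.
    - by rewrite sedge_sym; case: (altP (s' =P s)) => [->|]; rewrite ?apex //;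
        case: s s' {flat apex ridge} wv => -[] //= ->.
  rewrite /= !inE !negb_or !vw !(inj_eq injv) !andbT /=.
  by rewrite -!(inj_eq val_inj) /= !E1.
rewrite !edge_signE !edge_sign_None.
case/and5P=> xy yz yt /forallP xz /andP[/forallP xt /forallP zt].
have none a b : (forall s', ~~ sedge G s' a b) ->
    forall s', sedge G s' a b = false.
  by move=> h s'; apply/negbTE.
move/none in xz; move/none in xt; move/none in zt.
have opp a b : sedge G (~~ s) a b -> sedge G s a b = false.
  by move/sedge_disjoint; rewrite negbK => /negbTE.
(* All adjacencies in both signs, up to symmetry, collected as one rewrite rule. *)
have adj := (xy, yz, yt, xz, xt, zt, opp _ _ xy, opp _ _ yz,
  negbTE (sedge_disjoint yt), fun s' => sedge_irrefl G s').
have sC s' a b : sedge G s' a b = sedge G s' b a by exact: sedge_sym.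
(* The ridge is x, y, z and the apex is t; the default of [nth] is never reached, since [i < 3]. *)
exists s, 3, (fun i : 'I_3 => nth x [:: x; y; z] i), t; split; split=> //.
- move=> i j /eqP; rewrite nth_uniq //; first by move/eqP/val_inj.
  by move: u; rewrite -[[:: _; _; _; _]]/(rcons [:: x; y; z] t) rcons_uniq => /andP[].
- move=> i; apply: contraTneq u => <-.
  rewrite -[[:: _; _; _; _]]/(rcons [:: x; y; z] _) rcons_uniq negb_and negbK.
  by rewrite mem_nth.
- move=> v; have: v \in rcons [:: x; y; z] t by rewrite mem_uniq4.
  rewrite mem_rcons inE => /orP[/eqP|vl]; [by left | right].
  have Hi : index v [:: x; y; z] < 3 by rewrite -[3]/(size [:: x; y; z]) index_mem.
  by exists (Ordinal Hi); rewrite nth_index.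
- by case=> [[|[|[|?]]]] // ? [[|[|[|?]]]] // ? /=; rewrite ?adj // sC ?adj.
- by case=> [[|[|[|?]]]] // ? [[|[|[|?]]]] // ? /=; rewrite ?adj // sC ?adj.
- by case=> [[|[|[|?]]]] // ? /=; rewrite sC ?adj.
- by case=> [[|[|[|?]]]] // ? /=; rewrite sC ?adj.
Qed.

Lemma seo_occurs : signed_eliminable G <-> occurs seo_pattern.
Proof.
split=> [[nu [[f nuK fK] seo]] | [x [y [z [t [u /and4P[xyz xyt xzt yzt]]]]]]].
  have lt k : k < 4 -> k < #|V| by rewrite card4.
  (* The vertex in position [k] of the ordering, counted from 0. *)
  pose vtx k (Hk : k < 4) := f (Ordinal (lt k Hk)).
  have nuv k Hk : nu (@vtx k Hk) = k :> nat by rewrite fK.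
  have vtx_neq i j Hi Hj : i < j -> @vtx i Hi != @vtx j Hj.
    apply: contraTneq => /(congr1 (val \o nu)).
    by rewrite /= !nuv => ->; rewrite ltnn.
  have triple i j k Hi Hj Hk : i < j < k ->
      seo_triple (edge_sign (@vtx i Hi) (@vtx j Hj))
        (edge_sign (@vtx i Hi) (@vtx k Hk)) (edge_sign (@vtx j Hj) (@vtx k Hk)).
    case/andP=> ij jk.
    have nij : vtx i Hi != vtx j Hj by apply: vtx_neq.
    have nik : vtx i Hi != vtx k Hk by apply: vtx_neq; apply: ltn_trans jk.
    have njk : vtx j Hj != vtx k Hk by apply: vtx_neq.
    apply/all_boolP => s; rewrite !edge_signE.
    have [] := seo (vtx i Hi) (vtx j Hj) (vtx k Hk) _ _ _ s.
    - by rewrite /= !inE negb_or nij nik njk.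
    - by rewrite !nuv (ltn_trans ij jk).
    - by rewrite !nuv.
    rewrite [sedge _ _ (vtx k Hk) _]sedge_sym => E1 E2.
    (* The second instance, with the two smaller vertices exchanged, yields the third conjunct of
       [seo_triple]. *)
    have [] := seo (vtx j Hj) (vtx i Hi) (vtx k Hk) _ _ _ s.
    - by rewrite /= !inE negb_or eq_sym nij nik njk.
    - by rewrite !nuv.
    - by rewrite !nuv (ltn_trans ij jk).
    rewrite [sedge _ _ (vtx j Hj) (vtx i Hi)]sedge_sym => _ E3.
    apply/and3P; split; apply/implyP => /andP[]; auto.
  exists (@vtx 0 isT), (@vtx 1 isT), (@vtx 2 isT), (@vtx 3 isT); split.
    by rewrite (map_inj_uniq (can_inj fK)
      [:: Ordinal _; Ordinal _; Ordinal _; Ordinal _]).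
  by apply/and4P; split; apply: triple.
set l := [:: x; y; z; t] in u.
have idx v : index v l < #|V|.
  by rewrite card4 -[4]/(size l) index_mem mem_uniq4.
(* Conversely, the ordering numbers each vertex by its position in x, y, z, t. *)
exists (fun v => Ordinal (idx v)); split.
  apply: inj_card_bij; last by rewrite card_ord.
  move=> v w [] /(congr1 (nth x l)); by rewrite !nth_index ?mem_uniq4.
(* The pattern only provides the triples with [i < j]; [seo_tripleC] supplies those with [j < i]. *)
have triple i j k : i < k -> j < k -> k < 4 -> i != j ->
    seo_triple (edge_sign (nth x l i) (nth x l j))
      (edge_sign (nth x l i) (nth x l k)) (edge_sign (nth x l j) (nth x l k)).
  move: i j k => [|[|[|[|?]]]] [|[|[|[|?]]]] [|[|[|[|?]]]] //= _ _ _ _;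
    by rewrite // seo_tripleC edge_signC.
move=> a b c uabc /= ac bc s.
have/all_boolP/(_ s) : seo_triple (edge_sign a b) (edge_sign a c) (edge_sign b c).
  have nthK v : nth x l (index v l) = v by rewrite nth_index ?mem_uniq4.
  rewrite -(nthK a) -(nthK b) -(nthK c); apply: triple => //.
    by rewrite -[4]/(size l) index_mem mem_uniq4.
  apply: contraTneq uabc => /(congr1 (nth x l)); rewrite !nthK => ->.
  by rewrite /= inE eqxx.
rewrite !edge_signE (sedge_sym G s c b) => /and3P[E1 E2 _].
by split=> H1 H2; [move: E1 | move: E2]; rewrite H1 H2.
Qed.

End FourVertices.

Theorem proposition6p1 (V : finType) (G : sgraph V) (hV : #|V| = 4) :
  signed_eliminable G <->
    (exists (s : bool) (x : V), degree (sedge G s) x = 3) \/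
    [/\ forall s : bool, chordal (sedge G s),
        ~ mountain G
      & ~ alternating_4path G].
Proof.
have seo := seo_occurs G hV; have star := star_occurs G hV.
have cyc := cycle_occurs G hV; have mnt := mountain_occurs G hV.
have alt := path_occurs G; have cls := classification G hV.
split=> [/seo/cls[/star | [/cyc ? nm np]] | H]; first by left.
  by right; split=> // [/mnt | /alt].
apply/seo/cls; case: H => [/star | [/cyc ? nm np]]; first by left.
by right; split=> // [/mnt | /alt].
Qed.
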